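(* Let $(E,\rho)$ be a metrically convex pointed metric space. Then $\mathrm{SA}(E)$, the set of Lipschitz functionals on $E$ that attain their norm in the strong sense, is not dense (in the norm topology) in $\mathrm{Lip}_0(E)$.
   Context: A pointed metric space is a metric space $(E,\rho)$ with a distinguished point $0\in E$; it is always assumed that $E\setminus\{0\}\neq\emptyset$. $\mathrm{Lip}_0(E)$ is the real Banach space of all Lipschitz functions $f:E\to\mathbb{R}$ with $f(0)=0$, with norm $\|f\|=\sup\left\{\frac{|f(x)-f(y)|}{\rho(x,y)}: x,y\in E,\ x\neq y\right\}$. A functional $f\in\mathrm{Lip}_0(E)$ attains its norm in the strong sense if there are $x,y\in E$, $x\neq y$, with $\|f\|=\frac{|f(x)-f(y)|}{\rho(x,y)}$; the set of all such $f$ is denoted $\mathrm{SA}(E)$. The space $E$ is metrically convex if for every pair of distinct points $x,y\in E$ there is a curve $\ell\subset E$ which connects $x$ and $y$ and is isometric to the segment $[0,\rho(x,y)]\subset\mathbb{R}$. *)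

(* Defs.v *)
From HB Require Import structures.
From mathcomp Require Import all_boot all_order all_algebra.
From mathcomp Require Import all_classical all_reals all_analysis.

Set Implicit Arguments.
Unset Strict Implicit.
Unset Printing Implicit Defensive.

Import Order.TTheory GRing.Theory Num.Theory.
Import numFieldNormedType.Exports.

Local Open Scope classical_set_scope.
Local Open Scope ring_scope.

(* [k.-lipschitz] of MathComp-Analysis requires a normed module as domain. *)
Definition is_lipschitz (R : realType) (E : metricType R) (f : E -> R) : Prop :=
  exists k : R, forall x y : E, `|f x - f y| <= k * mdist x y.

Definition lip0 (R : realType) (E : metricType R) (o : E) : {pred (E -> R^o)} :=
  [pred f : E -> R^o | `[< is_lipschitz f >] && (f o == 0)].

Record Lip0 (R : realType) (E : metricType R) (o : E) := MkLip0 {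
  Lip0_fun :> E -> R^o ;
  Lip0P : Lip0_fun \in lip0 o }.

Definition diff_quotients (R : realType) (E : metricType R) (f : E -> R) : set R :=
  [set q : R | exists x y : E, x <> y /\ q = `|f x - f y| / mdist x y].

Definition lip_norm (R : realType) (E : metricType R) (f : E -> R) : R :=
  sup (diff_quotients f).

Section Lip0_normedModType.
Context (R : realType) (E : metricType R) (o : E).

HB.instance Definition _ := [isSub for @Lip0_fun R E o].
HB.instance Definition _ := [Choice of Lip0 o by <:].

Lemma lip0_submod_closed : submod_closed (lip0 o).
Proof.
split.
  apply/andP; split; last exact/eqP.
  by apply/asboolP; exists 0 => x y; rewrite subrr normr0 mul0r.
move=> a f g /andP[/asboolP[k kf] /eqP f0] /andP[/asboolP[l lg] /eqP g0].
apply/andP; split; last by apply/eqP; rewrite /= -[LHS]/(a * f o + g o) f0 g0 mulr0 addr0.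
apply/asboolP; exists (`|a| * k + l) => x y.
rewrite -[X in `|X|]/((a * f x + g x) - (a * f y + g y)).
rewrite opprD addrACA -mulrBr (le_trans (ler_normD _ _))// normrM mulrDl -mulrA.
by rewrite lerD// ler_wpM2l.
Qed.

HB.instance Definition _ :=
  GRing.isSubmodClosed.Build _ _ (lip0 o) lip0_submod_closed.
HB.instance Definition _ := [SubChoice_isSubLmodule of Lip0 o by <:].

Lemma Lip0_lipschitz (f : Lip0 o) : is_lipschitz f.
Proof. by have /andP[/asboolP] := Lip0P f. Qed.

Lemma Lip0_base (f : Lip0 o) : f o = 0.
Proof. by have /andP[_ /eqP] := Lip0P f. Qed.

Lemma diff_quotients_ub (f : Lip0 o) : has_ubound (diff_quotients f).
Proof.
have [k kf] := Lip0_lipschitz f.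
exists k => _ [x [y [/eqP xy ->]]].
by rewrite ler_pdivrMr ?mdist_gt0.
Qed.

Lemma lip_norm_ge0 (f : Lip0 o) : 0 <= lip_norm f.
Proof.
have [[q fq]|q0] := pselect (diff_quotients f !=set0).
  apply: (@le_trans _ _ q); last exact: (ub_le_sup (diff_quotients_ub f) fq).
  by case: fq => x [y [_ ->]]; rewrite divr_ge0 ?mdist_ge0.
by move/set0P/negP: q0; rewrite negbK /lip_norm => /eqP ->; rewrite sup0.
Qed.

Lemma lip_norm_bound (f : Lip0 o) (x y : E) :
  `|f x - f y| <= lip_norm f * mdist x y.
Proof.
have [->|/eqP xy] := pselect (x = y).
  by rewrite subrr normr0 mdistxx mulr0.
rewrite -ler_pdivrMr ?mdist_gt0//.
by apply: (ub_le_sup (diff_quotients_ub f)); exists x, y; split => //; exact/eqP.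
Qed.

Lemma lip_norm_le (f : Lip0 o) (k : R) : 0 <= k ->
  (forall x y, `|f x - f y| <= k * mdist x y) -> lip_norm f <= k.
Proof.
move=> k0 kf.
have [q0|q0] := pselect (diff_quotients f !=set0).
  by apply: ge_sup => // _ [x [y [/eqP xy ->]]]; rewrite ler_pdivrMr ?mdist_gt0.
by move/set0P/negP: q0; rewrite negbK /lip_norm => /eqP ->; rewrite sup0.
Qed.

Lemma lip_normD (f g : Lip0 o) :
  lip_norm (f + g : Lip0 o) <= lip_norm f + lip_norm g.
Proof.
apply: lip_norm_le => [|x y]; first by rewrite addr_ge0 ?lip_norm_ge0.
rewrite -[X in `|X|]/((f x + g x) - (f y + g y)) opprD addrACA.
by rewrite (le_trans (ler_normD _ _))// mulrDl lerD// lip_norm_bound.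
Qed.

Lemma lip_normZ_le (a : R) (f : Lip0 o) :
  lip_norm (a *: f : Lip0 o) <= `|a| * lip_norm f.
Proof.
apply: lip_norm_le => [|x y]; first by rewrite mulr_ge0 ?lip_norm_ge0.
rewrite -[X in `|X|]/(a * f x - a * f y) -mulrBr normrM -mulrA.
by rewrite ler_wpM2l// lip_norm_bound.
Qed.

Lemma lip_normZ (a : R) (f : Lip0 o) :
  lip_norm (a *: f : Lip0 o) = `|a| * lip_norm f.
Proof.
apply/eqP; rewrite eq_le lip_normZ_le andTb.
have [->|a0] := eqVneq a 0; first by rewrite normr0 mul0r; exact: lip_norm_ge0.
rewrite -ler_pdivlMl ?normr_gt0// -normfV.
by have := lip_normZ_le a^-1 (a *: f); rewrite scalerA mulVf// scale1r.
Qed.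

Lemma lip_norm_eq0 (f : Lip0 o) : lip_norm f = 0 -> f = 0.
Proof.
move=> f0; apply/val_inj/funext => x /=.
have := lip_norm_bound f x o.
by rewrite f0 mul0r Lip0_base subr0 normr_le0 => /eqP.
Qed.

HB.instance Definition _ := @Lmodule_isNormed.Build R (Lip0 o)
  (fun f => lip_norm f) lip_normD lip_normZ lip_norm_eq0.

Lemma Lip0_normE (f : Lip0 o) : `|f| = lip_norm f.
Proof. by []. Qed.

End Lip0_normedModType.

Definition SA (R : realType) (E : metricType R) (o : E) : set (Lip0 o) :=
  [set f : Lip0 o | exists x y : E, x <> y /\ `|f| = `|f x - f y| / mdist x y].
Arguments SA {R E} o.

(* [l] is the image of an isometric embedding [g] of the segment [0, mdist x y],
   whose endpoints are [x] and [y]. *)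
Definition metric_segment (R : realType) (E : metricType R) (x y : E) (l : set E) : Prop :=
  exists g : R -> E,
    [/\ g 0 = x, g (mdist x y) = y, l = g @` `[0, mdist x y] &
        {in `[0, mdist x y] &, forall s t : R, mdist (g s) (g t) = `|s - t|}].

Definition metrically_convex (R : realType) (E : metricType R) : Prop :=
  forall x y : E, x <> y -> exists l : set E, metric_segment x y l.

(* Main.v *)
Require Import Defs.
From mathcomp Require Import all_boot all_order all_algebra.
From mathcomp Require Import all_classical all_reals all_analysis.
From mathcomp Require Import ring lra.
Import Order.TTheory GRing.Theory Num.Theory.
Import numFieldNormedType.Exports.
Local Open Scope classical_set_scope.
Local Open Scope ring_scope.

(** Let [U] be an open set of reals that contains the rationals and has measure
    less than [d], and put [F s = |]0, s] \ U|]. Then [F] is nondecreasing and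
    1-Lipschitz, [F d > 0], and [F] is constant on each component of the dense
    open set [U]. With [d] the distance from [o] to another point, let
    [f z = F (rho z o)], a nonzero element of [Lip0 o]. If [g] attains its norm
    at [x], [y], then [g] is affine of slope [± |g|] along a geodesic from [x]
    to [y]. The distance to [o] varies continuously along this geodesic, so some
    two distinct points of it have the same value under [f]; comparing [f] and
    [g] there gives [|g| <= |f - g|]. Thus [|f| <= 2 |f - g|], and the ball of
    radius [|f| / 2] around [f] misses [SA o]. *)

(** The rationals are countable, hence null; outer regularity encloses them in an open set of small
    measure, which inherits their density. *)
Lemma open_dense_small_measure (R : realType) (e : R) : 0 < e ->
  exists U : set R, [/\ open U, dense U & (lebesgue_measure U < e%:E)%E].
Proof.
move=> e0; pose D : set R := ratr @` [set: rat].
have cD : countable D by exact: sub_countable (card_image_le _ _) (countableP _).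
have D0 : lebesgue_measure D = 0%E := countable_lebesgue_measure0 cD.
have mD : measurable D by exact: countable_measurable.
have [|U [oU DU UDe]] := @lebesgue_regularity_outer R D e mD _ e0.
  by rewrite [X in (X < _)%E]D0 ltry.
exists U; split => //.
  move=> O O0 oO; have [x [Ox Dx]] := @dense_rat R O O0 oO.
  by exists x; split => //; exact: DU.
have mU : measurable U by exact: measurable_realfun.open_measurable.
rewrite -(setDKU DU) (le_lt_trans (measureU2 _ _ _))//; first exact: measurableD.
by rewrite [X in (_ + X)%E]D0 adde0.
Qed.

(** * A 1-Lipschitz function that is flat on the intervals inside [U] *)

Section complement_measure.
Context {R : realType} (U : set R).
Hypothesis mU : measurable U.

Let mitvD (a b : R) : measurable (`]a, b] `\` U).
Proof. exact: measurableD. Qed.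

Let le_mu (A B : set R) : measurable A -> measurable B -> A `<=` B ->
  (lebesgue_measure A <= lebesgue_measure B)%E.
Proof. by move=> mA mB AB; rewrite le_measure ?inE. Qed.

Let mu_itvD (a b : R) : a <= b ->
  (lebesgue_measure (`]a, b] `\` U) <= (b - a)%:E)%E.
Proof.
move=> ab; apply: (@le_trans _ _ (lebesgue_measure (`]a, b]%classic : set R))).
  by apply: le_mu.
rewrite lebesgue_measure_itv/= lte_fin; case: ifPn => // _.
by rewrite lee_fin subr_ge0.
Qed.

Let mu_itvD_fin (a b : R) : lebesgue_measure (`]a, b] `\` U) \is a fin_num.
Proof.
have [ab|ba] := leP a b.
  by rewrite ge0_fin_numE// (le_lt_trans (mu_itvD _ _ ab))// ltry.
by rewrite set_itv_ge ?set0D ?measure0// -leNgt bnd_simp ltW.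
Qed.

(** [fine] loses nothing, since these measures are finite. For [s < 0] the interval is empty and the
    value is 0. *)
Definition complement_measure (s : R) : R :=
  fine (lebesgue_measure (`]0, s] `\` U)).

Lemma complement_measure0 : complement_measure 0 = 0.
Proof.
by rewrite /complement_measure set_itv_ge ?set0D ?measure0// bnd_simp ltxx.
Qed.

Lemma complement_measure_le (s t : R) : s <= t ->
  complement_measure s <= complement_measure t.
Proof.
move=> st; rewrite fine_le ?mu_itvD_fin//; apply: le_mu => //.
by apply: setSD; apply: subset_itvl; rewrite bnd_simp.
Qed.

Let complement_measure_incr (s t : R) :
  complement_measure t <=
    complement_measure s + fine (lebesgue_measure (`]s, t] `\` U)).
Proof.
rewrite -fineD// fine_le// ?fin_numD ?mu_itvD_fin//.
apply: le_trans (measureU2 lebesgue_measure (mitvD 0 s) (mitvD s t)).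
apply: le_mu => //; first exact: measurableU.
move=> x [/=]; rewrite in_itv/= => /andP[x0 xt] Ux.
have [xs|sx] := leP x s; [left|right]; split => //=; rewrite in_itv/=.
  by rewrite x0 xs.
by rewrite sx xt.
Qed.

Lemma complement_measure_lipschitz (s t : R) :
  `|complement_measure s - complement_measure t| <= `|s - t|.
Proof.
wlog st : s t / s <= t.
  by move=> h; have [/h//|/ltW/h] := leP s t; rewrite distrC (distrC t).
rewrite distrC (distrC s) !ger0_norm ?subr_ge0 ?complement_measure_le//.
rewrite lerBlDl (le_trans (complement_measure_incr s t))// lerD2l.
by rewrite -lee_fin fineK// mu_itvD.
Qed.

Lemma complement_measure_eq (s t : R) : s <= t -> `]s, t] `<=` U ->
  complement_measure s = complement_measure t.
Proof.
move=> st stU; apply/eqP; rewrite eq_le complement_measure_le//=.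
rewrite (le_trans (complement_measure_incr s t))//.
by rewrite (_ : `]s, t] `\` U = set0) ?measure0 ?addr0//; rewrite setD_eq0.
Qed.

(** Otherwise [U] would cover []0, d]] up to a null set and have measure at least [d]. *)
Lemma complement_measure_gt0 (d : R) : 0 < d ->
  (lebesgue_measure U < d%:E)%E -> 0 < complement_measure d.
Proof.
move=> d0 Ud; rewrite lt_def fine_ge0// andbT; apply/eqP => F0.
have : (lebesgue_measure (`]0%R, d]%classic : set R) <= lebesgue_measure U)%E.
  apply: (@le_trans _ _ (lebesgue_measure ((`]0%R, d] `\` U) `|` U))).
    apply: le_mu => //; first exact: measurableU.
    by move=> x xd; have [Ux|Ux] := pselect (U x); [right|left].
  apply: le_trans (measureU2 lebesgue_measure (mitvD 0 d) mU) _.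
  rewrite -[X in (X + _)%E]fineK ?mu_itvD_fin//.
  by rewrite -/(complement_measure d) F0 add0e.
rewrite lebesgue_measure_itv/= lte_fin d0 sube0.
by move=> /le_lt_trans/(_ Ud); rewrite ltxx.
Qed.

Lemma complement_measure_not_inj : open U -> dense U ->
  forall a b : R, a < b ->
  exists c c' : R, [/\ a <= c, c < c', c' <= b &
    complement_measure c = complement_measure c'].
Proof.
move=> oU dU a b ab.
have [|x xabU] :=
    dU `]a, b[%classic _ (@interval_open _ (BRight a) (BLeft b) isT isT).
  by exists ((a + b) / 2); rewrite /= in_itv/= !midf_lt.
have oabU : open (`]a, b[ `&` U) by exact: openI (interval_open _ _) oU.
have /nbhs_ballP[r /= r0 xr] : nbhs x (`]a, b[ `&` U).
  exact: open_nbhs_nbhs.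
(* Halving [r] keeps the right endpoint inside the open ball. *)
have xrabU y : x <= y -> y <= x + r / 2 -> (`]a, b[ `&` U) y.
  by move=> xy yxr; apply: xr; rewrite /ball/= ler0_norm; lra.
have [] := xrabU x; [by []|by lra|rewrite /= in_itv/= => /andP[ax _] _].
have [] := xrabU (x + r / 2); [by lra|by []|rewrite /= in_itv/= => /andP[_ xb] _].
exists x, (x + r / 2); split; [exact: ltW|lra|exact: ltW|].
apply: complement_measure_eq; first lra.
move=> y /=; rewrite in_itv/= => /andP[/ltW xy yxr].
by have [] := xrabU y xy yxr.
Qed.

End complement_measure.

(** * Behaviour along geodesics of functions that attain their norm *)

Section attained_norm.
Context {R : realType} {E : metricType R} {o : E}.

Lemma ler_mdist_dist (x y z : E) : `|mdist x z - mdist y z| <= mdist x y.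
Proof.
have := metric_triangle x y z; have := metric_triangle y x z.
by rewrite (metric_sym y x) ler_norml lerNl opprB !lerBlDr => -> ->.
Qed.

Definition isometric_path (D : R) (p : R -> E) : Prop :=
  {in `[0, D] &, forall s t : R, mdist (p s) (p t) = `|s - t|}.

(** Cut the path at [s] and [t]: each piece contributes at most [|g|] times its length, and a
    deficit on the middle piece would make the total less than [|g| * D]. *)
Lemma norm_attained_segment (g : Lip0 o) (D : R) (p : R -> E) (s t : R) :
  isometric_path D p -> 0 <= s -> s <= t -> t <= D ->
  `|g (p 0) - g (p D)| = `|g| * D ->
  `|g (p s) - g (p t)| = `|g| * (t - s).
Proof.
move=> pD s0 st tD gD.
have bnd a b : 0 <= a -> a <= b -> b <= D ->
    `|g (p a) - g (p b)| <= `|g| * (b - a).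
  move=> a0 ab bD; have := lip_norm_bound g (p a) (p b).
  rewrite pD ?in_itv/= ?a0 ?bD ?andbT/= ?(le_trans a0)// ?(le_trans ab)//.
  by rewrite (distrC a) (@ger0_norm _ (b - a)) ?subr_ge0.
apply/eqP; rewrite eq_le bnd//= leNgt; apply/negP => gst.
have := ler_distD (g (p s)) (g (p 0)) (g (p D)).
have := ler_distD (g (p t)) (g (p s)) (g (p D)).
have := bnd 0 s (lexx 0) s0 (le_trans st tD).
have := bnd t D (le_trans s0 st) tD (lexx D).
rewrite gD; move: gst; rewrite !mulrBr mulr0.
set A := `|g|; lra.
Qed.

Lemma mdist_path_continuous (D : R) (p : R -> E) (z : E) :
  isometric_path D p -> {within `[0, D], continuous (fun s => mdist (p s) z)}.
Proof.
move=> pD; apply/subspace_continuousP => s sD.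
apply/cvgrPdist_lt => e e0; apply/nbhs_ballP; exists e => //= t + tD.
rewrite /ball/= => ste; apply: le_lt_trans ste.
rewrite -(pD s t)//.
exact: ler_mdist_dist.
Qed.

(* The intermediate value theorem turns the non-injectivity of [F] on the range
   of [mdist (p _) z] into a coincidence along [p]. *)
Lemma not_inj_along_path (F : R -> R) (D : R) (p : R -> E) (z : E) :
  (forall a b : R, a < b -> exists c c' : R,
    [/\ a <= c, c < c', c' <= b & F c = F c']) ->
  0 < D -> isometric_path D p ->
  exists s t : R, [/\ 0 <= s, s < t, t <= D &
    F (mdist (p s) z) = F (mdist (p t) z)].
Proof.
move=> Fninj D0 pD; pose h s := mdist (p s) z.
(* If both ends are equally far from [z], they are the required points; otherwise [h] sweeps a
   nondegenerate interval. *)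
have [h0D|h0D] := eqVneq (h 0) (h D).
  by exists 0, D; split => //; rewrite -/(h 0) h0D.
have minmax : Num.min (h 0) (h D) < Num.max (h 0) (h D).
  by rewrite gt_min !lt_max !ltxx orbF -neq_lt.
have [c [c' [hc cc' c'h Fcc']]] := Fninj _ _ minmax.
have hIVT v : Num.min (h 0) (h D) <= v <= Num.max (h 0) (h D) ->
    exists2 s, s \in `[0, D] & h s = v.
  by apply: IVT (ltW D0) _; exact: mdist_path_continuous.
have [|s] := hIVT c; first by rewrite hc (le_trans (ltW cc')).
rewrite in_itv/= => /andP[s0 sD] hs.
have [|t] := hIVT c'; first by rewrite c'h (le_trans hc) ?ltW.
rewrite in_itv/= => /andP[t0 tD] ht.
(* The path may approach [z] or recede from it, so [s] and [t] come in either order; they differ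
   because [c < c']. *)
have [st|ts|st] := ltgtP s t.
- by exists s, t; rewrite -/(h s) -/(h t) hs ht.
- by exists t, s; rewrite -/(h s) -/(h t) hs ht.
- by move: cc'; rewrite -hs -ht st ltxx.
Qed.

Lemma lip0_comp_mdist (F : R -> R) : F 0 = 0 ->
  (forall s t : R, `|F s - F t| <= `|s - t|) ->
  (fun z : E => F (mdist z o)) \in lip0 o.
Proof.
move=> F0 FL; apply/andP; split; last by rewrite /= mdistxx F0.
apply/asboolP; exists 1 => x y.
by rewrite mul1r (le_trans (FL _ _))// ler_mdist_dist.
Qed.

(** Between two points of the geodesic where [f] agrees, [f - g] varies exactly as much as [g],
    which is [|g|] times their distance. *)
Lemma SA_dist_ge (f g : Lip0 o) (F : R -> R) : metrically_convex E ->
  (forall z : E, f z = F (mdist z o)) ->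
  (forall a b : R, a < b -> exists c c' : R,
    [/\ a <= c, c < c', c' <= b & F c = F c']) ->
  SA o g -> `|g| <= `|f - g|.
Proof.
move=> cvxE fF Fninj [x [y [xy gxy]]].
have [_ [p [p0 pD _ isop]]] := cvxE x y xy.
have D0 : 0 < mdist x y by rewrite mdist_gt0; exact/eqP.
have [s [t [s0 st tD Fst]]] := not_inj_along_path F (mdist x y) p o Fninj D0 isop.
have gst : `|g (p s) - g (p t)| = `|g| * (t - s).
  apply: (norm_attained_segment _ _ _ _ _ isop) => //; first exact: ltW.
  by rewrite p0 pD gxy divfK// gt_eqF.
have := lip_norm_bound (f - g) (p s) (p t).
rewrite -[X in `|X|]/((f (p s) - g (p s)) - (f (p t) - g (p t))).
rewrite !fF Fst opprB [X in `|X|](_ : _ = g (p t) - g (p s)); last by ring.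
rewrite distrC gst isop ?in_itv/= ?s0 ?tD ?andbT ?(le_trans s0)//=; try lra.
rewrite distrC ger0_norm ?subr_ge0 ?(ltW st)//.
by rewrite ler_pM2r ?subr_gt0.
Qed.

End attained_norm.

Theorem theorem2p3 (R : realType) (E : metricType R) (o : E)
    (E_nontrivial : [set~ o] !=set0) (E_convex : metrically_convex E) :
  ~ dense (SA o).
Proof.
have [e /= /eqP eo] := E_nontrivial.
have d0 : 0 < mdist e o by rewrite mdist_gt0.
(* Bounding the measure of [U] by [mdist e o] makes [f e] positive below. *)
have [U [oU dU Ud]] := open_dense_small_measure _ _ d0.
have mU : measurable U by exact: measurable_realfun.open_measurable.
have FP := @lip0_comp_mdist R E o (complement_measure U) (complement_measure0 U)
  (complement_measure_lipschitz U mU).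
pose f : Lip0 o := @MkLip0 R E o _ FP.
have f0 : 0 < `|f|.
  rewrite normr_gt0; apply/eqP => /(congr1 (fun h : Lip0 o => h e)) fe.
  have := complement_measure_gt0 U mU _ d0 Ud.
  by rewrite -[complement_measure _ _]/(f e) fe ltxx.
move=> /(_ (ball f (`|f| / 2))) [||g [fg SAg]].
- by exists f; apply: ballxx; rewrite divr_gt0.
- exact: ball_open.
have := SA_dist_ge f g (complement_measure U) E_convex (fun=> erefl)
  (complement_measure_not_inj U mU oU dU) SAg.
move: fg; rewrite -ball_normE/= => fg gfg.
have := ler_normD (f - g) g; rewrite subrK; lra.
Qed.
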